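(* Let $L$ be an $\omega$-regular language that is not GFG-helpful. Then every two nice tDCWs for $L$ that are minimal (have the minimum number of states among tDCWs recognizing $L$) are safe isomorphic.
   Context: A tNCW is $\mathcal{A}=\langle \Sigma,Q,q_0,\delta,\alpha\rangle$ with finite alphabet $\Sigma$, finite state set $Q$, initial state $q_0$, total transition function $\delta:Q\times\Sigma\to 2^Q\setminus\{\emptyset\}$ with transition relation $\Delta=\{\langle q,\sigma,s\rangle: s\in\delta(q,\sigma)\}$, and $\alpha\subseteq\Delta$ ($\alpha$-transitions; the rest are $\bar\alpha$-transitions); $\delta^{\bar\alpha}(q,\sigma)$ is the set of $\sigma$-successors of $q$ via $\bar\alpha$-transitions. A run on $w=\sigma_1\sigma_2\cdots$ is $r_0r_1\cdots$ with $r_0=q_0$, $r_{i+1}\in\delta(r_i,\sigma_{i+1})$, accepting iff it traverses $\alpha$-transitions only finitely often. A tDCW is a tNCW with $|\delta(q,\sigma)|=1$ for all $q,\sigma$. $\mathcal{A}^q$ is $\mathcal{A}$ with initial state $q$; $q\sim s$ iff $L(\mathcal{A}^q)=L(\mathcal{A}^s)$. $\mathcal{A}$ is GFG if there is $f:\Sigma^*\to Q$ with $f(\epsilon)=q_0$, $\langle f(u),\sigma,f(u\sigma)\rangle\in\Delta$ for all $u,\sigma$, and for every $w\in L(\mathcal{A})$ the run $f(w[1,0]),f(w[1,1]),\dots$ is accepting; a state $q$ is GFG if $\mathcal{A}^q$ is (every tDCW is GFG). A GFG-tNCW is nice if all states are reachable and GFG and it is normal (a path of $\bar\alpha$-transitions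 from $q$ to $s$ implies one from $s$ to $q$), safe deterministic ($|\delta^{\bar\alpha}(q,\sigma)|\le1$) and semantically deterministic (any two $\sigma$-successors of a state are $\sim$-equivalent). $L$ is GFG-helpful if the minimum number of states of a tDCW for $L$ is larger than the minimum number of states of a GFG-tNCW for $L$. Two tNCWs with state sets $Q_\mathcal{A},Q_\mathcal{B}$ are safe isomorphic if there is a bijection $\kappa:Q_\mathcal{A}\to Q_\mathcal{B}$ such that $q'\in\delta^{\bar\alpha}_\mathcal{A}(q,\sigma)$ iff $\kappa(q')\in\delta^{\bar\alpha}_\mathcal{B}(\kappa(q),\sigma)$ for all $q,q',\sigma$. *)

(* Defs.v *)
From mathcomp Require Import all_boot.

Set Implicit Arguments.
Unset Strict Implicit.
Unset Printing Implicit Defensive.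

(* The word sigma_1 sigma_2 ... is w with w i = sigma_(i+1). *)
Definition omega_word (Sigma : finType) := nat -> Sigma.
Definition omega_language (Sigma : finType) := omega_word Sigma -> Prop.

Record NBW (Sigma : finType) := MkNBW {
  nbw_state : finType;
  nbw_init : {set nbw_state};
  nbw_delta : nbw_state -> Sigma -> {set nbw_state};
  nbw_acc : {set nbw_state}
}.

Definition nbw_language (Sigma : finType) (B : NBW Sigma) :
    omega_language Sigma :=
  fun w => exists r : nat -> nbw_state B,
    [/\ r 0 \in nbw_init B,
        forall i, r i.+1 \in nbw_delta (r i) (w i)
      & forall n, exists2 i, n <= i & r i \in nbw_acc B].

Definition omega_regular (Sigma : finType) (L : omega_language Sigma) : Prop :=
  exists B : NBW Sigma, forall w, nbw_language B w <-> L w.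

Record tNCW (Sigma : finType) := MkTNCW {
  state : finType;
  init : state;
  delta : state -> Sigma -> {set state};
  alpha : {set state * Sigma * state};
  delta_total : forall q a, delta q a != set0;
  alpha_sub : forall q a s, (q, a, s) \in alpha -> s \in delta q a
}.

Section Automata.
Variable Sigma : finType.
Implicit Types (A : tNCW Sigma) (L : omega_language Sigma).

Definition safe_delta A (q : state A) (a : Sigma) : {set state A} :=
  [set s in delta q a | (q, a, s) \notin alpha A].

Definition is_run A (w : omega_word Sigma) (r : nat -> state A) : Prop :=
  r 0 = init A /\ forall i, r i.+1 \in delta (r i) (w i).

Definition accepting A (w : omega_word Sigma) (r : nat -> state A) : Prop :=
  exists n, forall i, n <= i -> (r i, w i, r i.+1) \notin alpha A.

Definition language A : omega_language Sigma :=
  fun w => exists2 r : nat -> state A, is_run w r & accepting w r.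

Definition recognizes A L : Prop := forall w, language A w <-> L w.

Definition with_init A (q : state A) : tNCW Sigma :=
  MkTNCW q (@delta_total _ A) (@alpha_sub _ A).

Definition state_equiv A (q s : state A) : Prop :=
  forall w, language (with_init q) w <-> language (with_init s) w.

Definition deterministic A : Prop :=
  forall (q : state A) a, #|delta q a| = 1.

Definition GFG A : Prop :=
  exists f : seq Sigma -> state A,
    [/\ f [::] = init A,
        forall u a, f (rcons u a) \in delta (f u) a
      & forall w, language A w -> accepting w (fun i => f (mkseq w i))].

Definition step A : rel (state A) :=
  fun q s => [exists a, s \in delta q a].

Definition safe_step A : rel (state A) :=
  fun q s => [exists a, s \in safe_delta q a].

Definition all_reachable A : Prop :=
  forall q : state A, connect (@step A) (init A) q.

Definition all_GFG A : Prop :=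
  forall q : state A, GFG (with_init q).

Definition normal A : Prop :=
  forall q s : state A,
    connect (@safe_step A) q s -> connect (@safe_step A) s q.

Definition safe_deterministic A : Prop :=
  forall (q : state A) a, #|safe_delta q a| <= 1.

Definition semantically_deterministic A : Prop :=
  forall (q : state A) a s s',
    s \in delta q a -> s' \in delta q a -> state_equiv s s'.

Definition nice A : Prop :=
  GFG A /\
  [/\ all_reachable A, all_GFG A, normal A, safe_deterministic A
    & semantically_deterministic A].

Definition tDCW_for L A : Prop := deterministic A /\ recognizes A L.

Definition GFG_tNCW_for L A : Prop := GFG A /\ recognizes A L.

Definition min_states (P : tNCW Sigma -> Prop) (n : nat) : Prop :=
  (exists2 A, P A & #|state A| = n) /\ forall A, P A -> n <= #|state A|.

Definition GFG_helpful L : Prop :=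
  exists m n, [/\ min_states (tDCW_for L) m, min_states (GFG_tNCW_for L) n
                & n < m].

Definition minimal_tDCW_for L A : Prop :=
  tDCW_for L A /\ min_states (tDCW_for L) #|state A|.

Definition safe_isomorphic A B : Prop :=
  exists2 kappa : state A -> state B, bijective kappa &
    forall (q q' : state A) a,
      q' \in safe_delta q a <-> kappa q' \in safe_delta (kappa q) a.

End Automata.

(* Main.v *)
Require Import Defs.
From mathcomp Require Import all_boot.
From mathcomp Require boolp.

(** Since [L] is not GFG-helpful, [A] and [B] have the minimum number of states
    even among GFG-tNCWs.  Write [q <= s] when [q] and [s] are equivalent and
    every finite word safe from [q] is safe from [s].

    If a set [K] of states of [A] contains an upper bound of every state and is
    closed under safe transitions up to the equivalence induced by [<=], then
    [L] has a GFG-tNCW with state space [K]: it keeps the safe transitions, and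
    its alpha-transitions lead to all states with the correct residual language.
    The strategy follows the run of [A], and on an alpha-transition jumps to an
    upper bound of the current state of [A].  Hence [K] is everything.
    Removing one state, or a whole safe component, shows that [<=] is
    antisymmetric on [A] and relates only states of the same safe component.

    By pumping safe cycles, each state of [A] lies below a state of [B] and
    vice versa.  So a maximal state of [A] has a [<=]-equivalent state of [B],
    and this propagates along safe paths to its whole safe component. *)

Set Implicit Arguments.
Unset Strict Implicit.
Unset Printing Implicit Defensive.

(** * Runs along [succ], residual equivalence and the safe preorder *)

Section Residuals.
Variable Sigma : finType.
Implicit Types (A B C : tNCW Sigma) (w : omega_word Sigma) (u v : seq Sigma).

(* The default value [q] is never used, as [delta q a] is nonempty. *)
Definition succ A (q : state A) (a : Sigma) : state A :=
  odflt q [pick s in delta q a].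

Definition safe A (q : state A) (a : Sigma) : bool :=
  (q, a, succ q a) \notin alpha A.

Fixpoint safe_word A (q : state A) u : bool :=
  if u is a :: u' then safe q a && safe_word (succ q a) u' else true.

Fixpoint det_run A (q : state A) w (i : nat) : state A :=
  if i is j.+1 then succ (det_run q w j) (w j) else q.

(** Meaningful under [deterministic A], where [language_with_init] identifies it with the language
    of [with_init q]. *)
Definition det_lang A (q : state A) w : Prop :=
  exists n, forall i, n <= i -> safe (det_run q w i) (w i).

Definition equiv A B (q : state A) (s : state B) : Prop :=
  forall w, det_lang q w <-> det_lang s w.

Definition safe_le A B (q : state A) (s : state B) : Prop :=
  equiv q s /\ forall u, safe_word q u -> safe_word s u.

Definition safe_eq A B (q : state A) (s : state B) : Prop :=
  safe_le q s /\ safe_le s q.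

Lemma det_run_add A (q : state A) w n i :
  det_run q w (n + i) = det_run (det_run q w n) (fun j => w (n + j)) i.
Proof. by elim: i => [|i IHi]; rewrite ?addn0 // addnS /= IHi. Qed.

Lemma det_lang_shift A (q : state A) w n :
  det_lang q w <-> det_lang (det_run q w n) (fun j => w (n + j)).
Proof.
split=> -[m Hm].
  exists m => i le_mi; rewrite -det_run_add; apply: Hm.
  exact: leq_trans le_mi (leq_addl _ _).
exists (n + m) => i le_i.
have le_ni : n <= i by exact: leq_trans (leq_addr _ _) le_i.
have := Hm (i - n); rewrite -det_run_add subnKC //; apply.
by rewrite leq_subRL.
Qed.

Lemma equiv_sym A B (q : state A) (s : state B) : equiv q s -> equiv s q.
Proof. by move=> H w; split=> /H. Qed.

Lemma equiv_trans A B C (q : state A) (s : state B) (t : state C) :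
  equiv q s -> equiv s t -> equiv q t.
Proof. by move=> H K w; split=> [/H/K|/K/H]. Qed.

Lemma equiv_succ A B (q : state A) (s : state B) a :
  equiv q s -> equiv (succ q a) (succ s a).
Proof.
move=> H w; pose aw i := if i is j.+1 then w j else a.
have E D (p : state D) : det_lang (succ p a) w <-> det_lang p aw.
  exact: iff_sym (det_lang_shift p aw 1).
by rewrite !E.
Qed.

Lemma equiv_foldl A B (q : state A) (s : state B) u :
  equiv q s -> equiv (foldl (@succ A) q u) (foldl (@succ B) s u).
Proof. by elim: u q s => //= a u IHu q s /(equiv_succ a)/IHu. Qed.

Lemma safe_word_cat A (q : state A) u v :
  safe_word q (u ++ v) = safe_word q u && safe_word (foldl (@succ A) q u) v.
Proof. by elim: u q => //= a u IHu q; rewrite IHu andbA. Qed.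

Lemma det_run_foldl A (q : state A) w n :
  det_run q w n = foldl (@succ A) q (mkseq w n).
Proof.
by elim: n => // n IHn; rewrite mkseqS foldl_rcons -IHn.
Qed.

Lemma safe_wordP A (q : state A) w n :
  reflect (forall i, i < n -> safe (det_run q w i) (w i))
          (safe_word q (mkseq w n)).
Proof.
elim: n => [|n IHn]; first by left.
rewrite mkseqS -cats1 safe_word_cat /=.
rewrite andbT -det_run_foldl.
apply: (iffP andP) => [[/IHn H1 H2] i|H].
  by rewrite ltnS leq_eqVlt => /predU1P[->|/H1].
by split; [apply/IHn => i lt_in; apply: H; exact: ltnW | exact: H].
Qed.

Lemma safe_le_run A B (q : state A) (s : state B) w :
  safe_le q s -> (forall i, safe (det_run q w i) (w i)) ->
  forall i, safe (det_run s w i) (w i).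
Proof.
move=> [_ H] Hq i; have /H/safe_wordP : safe_word q (mkseq w i.+1).
  by apply/safe_wordP.
by apply.
Qed.

Lemma safe_le_refl A (q : state A) : safe_le q q.
Proof. by []. Qed.

Lemma safe_le_trans A B C (q : state A) (s : state B) (t : state C) :
  safe_le q s -> safe_le s t -> safe_le q t.
Proof.
move=> [Eqs Sqs] [Est Sst]; split; first exact: equiv_trans Eqs Est.
by move=> u /Sqs/Sst.
Qed.

(** If [v] is safe after [u], then [u ++ v] is safe from [q], hence from [s]. *)
Lemma safe_le_foldl A B (q : state A) (s : state B) u :
  safe_le q s -> safe_word q u ->
  safe_le (foldl (@succ A) q u) (foldl (@succ B) s u).
Proof.
move=> [E S] su; split; first exact: equiv_foldl.
move=> v sv; have : safe_word s (u ++ v) by apply: S; rewrite safe_word_cat su.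
by rewrite safe_word_cat => /andP[].
Qed.

Lemma safe_eq_sym A B (q : state A) (s : state B) : safe_eq q s -> safe_eq s q.
Proof. by case. Qed.

Lemma safe_eq_trans A B C (q : state A) (s : state B) (t : state C) :
  safe_eq q s -> safe_eq s t -> safe_eq q t.
Proof.
move=> [H1 H2] [H3 H4].
by split; [exact: safe_le_trans H1 H3 | exact: safe_le_trans H4 H2].
Qed.

Lemma safe_eq_safe A B (q : state A) (s : state B) a :
  safe_eq q s -> safe q a = safe s a.
Proof.
move=> [[_ H] [_ K]]; apply/idP/idP => sa.
  by have := H [:: a]; rewrite /= !andbT; apply.
by have := K [:: a]; rewrite /= !andbT; apply.
Qed.

Lemma safe_eq_foldl A B (q : state A) (s : state B) u :
  safe_eq q s -> safe_word q u ->
  safe_eq (foldl (@succ A) q u) (foldl (@succ B) s u).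
Proof.
move=> [H K] su; split; apply: safe_le_foldl => //.
by case: H => _; apply.
Qed.

(** * Deterministic automata: runs and paths through [succ] *)

Section Deterministic.
Variables (A : tNCW Sigma) (A_det : deterministic A).

Lemma deltaE (q : state A) a : delta q a = [set succ q a].
Proof.
have /eqP/cards1P[s Es] := A_det q a.
rewrite /succ; case: pickP => [t|/(_ s)]; rewrite Es inE ?eqxx //.
by move/eqP->.
Qed.

Lemma safe_deltaE (q s : state A) a :
  (s \in safe_delta q a) = safe q a && (s == succ q a).
Proof.
rewrite inE deltaE inE andbC /safe.
by case: eqP => [->|]; rewrite ?andbT ?andbF.
Qed.

Lemma language_with_init (q : state A) w :
  language (with_init q) w <-> det_lang q w.
Proof.
split=> [[r [r0 rS] [n Hn]]|[n Hn]].
  have E i : r i = det_run q w i.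
    elim: i => [|i IHi]; first exact: r0.
    by have := rS i; rewrite [delta _ _]deltaE inE IHi => /eqP.
  by exists n => i /Hn; rewrite !E.
exists (det_run q w); last by exists n.
by split=> // i; rewrite [delta _ _]deltaE inE.
Qed.

Lemma connect_safe_word (q s : state A) :
  connect (@safe_step _ A) q s <->
  exists2 u, safe_word q u & foldl (@succ A) q u = s.
Proof.
split.
  move=> /connectP[p]; elim: p q => [|t p IHp] q /=.
    by move=> _ ->; exists [::].
  case/andP => /existsP[a]; rewrite safe_deltaE => /andP[sa /eqP Et] Hp Es.
  by have [u su Eu] := IHp t Hp Es; exists (a :: u); rewrite /= -Et // sa.
move=> [u]; elim: u q => [|a u IHu] q /=; first by move=> _ ->.
case/andP => sa su /(IHu _ su); apply: connect_trans; apply: connect1.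
by apply/existsP; exists a; rewrite safe_deltaE sa eqxx.
Qed.

Lemma connect_step_word (q s : state A) :
  connect (@step _ A) q s -> exists u, foldl (@succ A) q u = s.
Proof.
move=> /connectP[p]; elim: p q => [|t p IHp] q /=.
  by move=> _ ->; exists [::].
case/andP => /existsP[a]; rewrite deltaE inE => /eqP Et Hp Es.
by have [u Eu] := IHp t Hp Es; exists (a :: u); rewrite /= -Et.
Qed.

End Deterministic.

(** * GFG-tNCWs on a subset of the states of a deterministic automaton *)

Section Restriction.
Variables (A : tNCW Sigma) (A_det : deterministic A) (K : {set state A}).

Let T := {k : state A | k \in K}.

Variables (nxt : T -> Sigma -> T) (jump : state A -> T).
Hypothesis nxtP : forall k a, safe (val k) a ->
  safe_eq (val (nxt k a)) (succ (val k) a).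
Hypothesis jumpP : forall q, safe_le q (val (jump q)).

Definition restr_delta (k : T) (a : Sigma) : {set T} :=
  [set t | boolp.asbool (equiv (succ (val k) a) (val t))].

(** Even on a safe letter, moves to states other than [nxt] are alpha-transitions, so a run that
    avoids alpha is forced to follow [nxt]. *)
Definition restr_alpha : {set T * Sigma * T} :=
  [set x | (x.2 \in restr_delta x.1.1 x.1.2) &&
           ~~ (safe (val x.1.1) x.1.2 && (x.2 == nxt x.1.1 x.1.2))].

Lemma restr_deltaP k a t :
  reflect (equiv (succ (val k) a) (val t)) (t \in restr_delta k a).
Proof. by rewrite inE; exact: boolp.asboolP. Qed.

Lemma restr_alphaE k a t :
  ((k, a, t) \in restr_alpha) =
  (t \in restr_delta k a) && ~~ (safe (val k) a && (t == nxt k a)).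
Proof. by rewrite in_set. Qed.

Lemma restr_delta_total k a : restr_delta k a != set0.
Proof.
apply/set0Pn; exists (jump (succ (val k) a)); apply/restr_deltaP.
by case: (jumpP (succ (val k) a)).
Qed.

Lemma restr_alpha_sub k a t :
  (k, a, t) \in restr_alpha -> t \in restr_delta k a.
Proof. by rewrite restr_alphaE => /andP[]. Qed.

Definition restr : tNCW Sigma :=
  MkTNCW (jump (init A)) restr_delta_total restr_alpha_sub.

Lemma restr_safe k a t :
  t \in restr_delta k a -> (k, a, t) \notin restr_alpha ->
  safe (val k) a /\ t = nxt k a.
Proof. by rewrite restr_alphaE => -> /=; rewrite negbK => /andP[? /eqP]. Qed.

(** A run always stays in the residual class of the run of [A]. Past its last alpha-transition it
    follows [nxt], hence is [safe_eq] to the run of [A] from [val (r n)], which is therefore safe;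
    [E] at [n] carries acceptance back to [init A]. *)
Lemma restr_sound w : language restr w -> det_lang (init A) w.
Proof.
move=> [r [r0 rS] [n Hn]].
have E i : equiv (det_run (init A) w i) (val (r i)).
  elim: i => [|i IHi]; first by rewrite r0; case: (jumpP (init A)).
  by apply: equiv_trans (equiv_succ _ IHi) _; apply/restr_deltaP/rS.
apply/(det_lang_shift _ _ n)/E; exists 0 => i _.
have [Er S] : safe_eq (val (r (n + i)))
    (det_run (val (r n)) (fun j => w (n + j)) i) /\
    safe (val (r (n + i))) (w (n + i)).
  elim: i => [|i [IHi si]].
    by rewrite addn0; split=> //; case: (restr_safe (rS n) (Hn n (leqnn n))).
  have [_ Enxt] := restr_safe (rS (n + i)) (Hn _ (leq_addr _ _)).
  split; last first.
    by case: (restr_safe (rS (n + i.+1)) (Hn _ (leq_addr _ _))).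
  rewrite addnS Enxt; apply: safe_eq_trans (nxtP si) _ => /=.
  by have := safe_eq_foldl (u := [:: w (n + i)]) IHi; rewrite /= si; apply.
by rewrite -(safe_eq_safe _ Er).
Qed.

(** The first component simulates [A], to know where to jump; the second is the state played in
    [restr]. *)
Definition strategy_step (x : state A * T) (a : Sigma) : state A * T :=
  (succ x.1 a, if safe (val x.2) a then nxt x.2 a else jump (succ x.1 a)).

Definition strategy_pair u : state A * T :=
  foldl strategy_step (init A, jump (init A)) u.

Lemma strategy_pair1 u : (strategy_pair u).1 = foldl (@succ A) (init A) u.
Proof.
by elim/last_ind: u => // u a; rewrite /strategy_pair !foldl_rcons /= => ->.
Qed.

Lemma strategy_pair_equiv u :
  equiv (strategy_pair u).1 (val (strategy_pair u).2).
Proof.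
elim/last_ind: u => [|u a]; first by case: (jumpP (init A)).
rewrite /strategy_pair foldl_rcons -/(strategy_pair u) /= => IHu.
case: ifP => sa; last by case: (jumpP (succ (strategy_pair u).1 a)).
apply: equiv_trans (equiv_succ a IHu) _; apply: equiv_sym.
by case: (nxtP sa) => [[]].
Qed.

Lemma strategy_delta u a :
  (strategy_pair (rcons u a)).2 \in restr_delta (strategy_pair u).2 a.
Proof.
apply/restr_deltaP; apply: equiv_trans (strategy_pair_equiv _).
rewrite [strategy_pair (rcons u a)]/strategy_pair foldl_rcons /=.
exact/equiv_sym/equiv_succ/strategy_pair_equiv.
Qed.

(** From [n] on the run of [A] is safe, so a jump at some [m >= n] lands above a state with a safe
    future, and no further jump follows. *)
Lemma strategy_accepting w : det_lang (init A) w ->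
  @accepting _ restr w (fun i => (strategy_pair (mkseq w i)).2).
Proof.
move=> [n Hn]; pose k i := (strategy_pair (mkseq w i)).2.
have kS i : k i.+1 = if safe (val (k i)) (w i) then nxt (k i) (w i)
                     else jump (det_run (init A) w i.+1).
  rewrite /k mkseqS /strategy_pair foldl_rcons /=.
  by rewrite -/(strategy_pair _) strategy_pair1 det_run_foldl.
have notin_alpha i : safe (val (k i)) (w i) ->
    (k i, w i, k i.+1) \notin restr_alpha.
  by move=> si; rewrite restr_alphaE kS si eqxx andbF.
case: (boolp.pselect (exists2 m, n <= m & ~~ safe (val (k m)) (w m))); last first.
  move=> no_jump; exists n => i le_ni; apply: notin_alpha.
  by case: (boolP (safe _ _)) => // H; case: no_jump; exists i.
move=> [m le_nm jm]; exists m.+1 => i le_mi; apply: notin_alpha.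
have km : k m.+1 = jump (det_run (init A) w m.+1) by rewrite kS (negPf jm).
pose w' j := w (m.+1 + j).
have safe_k0 j : safe (det_run (val (k m.+1)) w' j) (w' j).
  move: j; apply: safe_le_run; first by rewrite km; exact: jumpP.
  move=> j; rewrite -det_run_add; apply: Hn.
  exact: leq_trans (leq_trans le_nm (leqnSn m)) (leq_addr _ _).
(* [nxt] agrees with [succ] only up to [safe_eq], so the strategy is compared with the true run of
   [A] from the landing state. *)
have Ek j : safe_eq (det_run (val (k m.+1)) w' j) (val (k (m.+1 + j))).
  elim: j => [|j IHj]; first by rewrite addn0.
  have sj : safe (val (k (m.+1 + j))) (w (m.+1 + j)).
    by rewrite -(safe_eq_safe _ IHj); exact: safe_k0.
  rewrite addnS (kS (m.+1 + j)) sj; apply: safe_eq_trans (safe_eq_sym (nxtP sj)).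
  by have := safe_eq_foldl (u := [:: w' j]) IHj; rewrite /= safe_k0; apply.
by rewrite -(subnKC le_mi) -(safe_eq_safe _ (Ek _)); exact: safe_k0.
Qed.

Lemma restr_complete w : det_lang (init A) w -> language restr w.
Proof.
move=> /strategy_accepting acc; exists (fun i => (strategy_pair (mkseq w i)).2) => //.
split=> // i; rewrite mkseqS; exact: strategy_delta.
Qed.

Lemma restr_GFG : GFG restr.
Proof.
exists (fun u => (strategy_pair u).2); split=> //; first exact: strategy_delta.
by move=> w /restr_sound/strategy_accepting.
Qed.

End Restriction.

Lemma language_det A w : deterministic A ->
  language A w <-> det_lang (init A) w.
Proof. by case: A => Q q0 d al dt als A_det; exact: (language_with_init A_det). Qed.

Lemma restriction_GFG_tNCW A (L : omega_language Sigma) (K : {set state A}) :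
  deterministic A -> recognizes A L ->
  (forall q : state A, exists2 k : state A, k \in K & safe_le q k) ->
  (forall (k : state A) a, k \in K -> safe k a ->
     exists2 k' : state A, k' \in K & safe_eq k' (succ k a)) ->
  exists2 C, GFG_tNCW_for L C & #|state C| = #|K|.
Proof.
move=> A_det AL K_top K_closed; pose T := {k : state A | k \in K}.
have /boolp.choice[jump jumpP] (q : state A) : exists t : T, safe_le q (val t).
  by have [k kK] := K_top q; exists (Sub k kK).
(* The safety guard makes the relation total: on an unsafe letter [k] itself is a dummy value. *)
have /boolp.choice[nxt nxtP] (x : T * Sigma) : exists t : T,
    safe (val x.1) x.2 -> safe_eq (val t) (succ (val x.1) x.2).
  case: x => k a /=; case: (boolP (safe (val k) a)) => [sa|_].
    by have [k' k'K E] := K_closed _ _ (valP k) sa; exists (Sub k' k'K).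
  by exists k.
have nP k a : safe (val k) a -> safe_eq (val (nxt (k, a))) (succ (val k) a).
  exact: (nxtP (k, a)).
exists (restr (fun k a => nxt (k, a)) jumpP); last first.
  by rewrite card_sig; apply: eq_card => x.
split; first exact: restr_GFG.
move=> w; rewrite -AL (language_det w A_det); split; first exact: restr_sound.
exact: restr_complete.
Qed.

(** Among the states above [q], take [p] with the most states below it: a state [p'] above [p] has
    the same states below it, and [p'] is one of them. *)
Lemma safe_le_maximal A (q : state A) :
  exists2 p : state A, safe_le q p & forall p' : state A, safe_le p p' -> safe_le p' p.
Proof.
pose below (p : state A) := [set x : state A | boolp.asbool (safe_le x p)].
have q_q : boolp.asbool (safe_le q q) by apply/boolp.asboolP.
have [p /boolp.asboolP le_qp p_max] :=
  @arg_maxnP _ q (fun p : state A => boolp.asbool (safe_le q p)) (fun p => #|below p|) q_q.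
exists p => // p' le_pp'.
have sub : below p \subset below p'.
  apply/subsetP => x; rewrite !inE => /boolp.asboolP le_xp.
  by apply/boolp.asboolP; exact: safe_le_trans le_xp le_pp'.
have le_card : #|below p'| <= #|below p|.
  by apply: p_max; apply/boolp.asboolP; exact: safe_le_trans le_qp le_pp'.
have /eqP/setP/(_ p') : below p == below p' by rewrite eqEcard sub.
rewrite !inE (boolp.asboolT (safe_le_refl p')).
by move=> /boolp.asboolP.
Qed.

(** * Consequences of minimality among GFG-tNCWs *)

Definition GFG_minimal (L : omega_language Sigma) A : Prop :=
  recognizes A L /\ forall C, GFG_tNCW_for L C -> #|state A| <= #|state C|.

Section Minimal.
Variables (A : tNCW Sigma) (A_det : deterministic A).
Variables (L : omega_language Sigma) (A_min : GFG_minimal L A).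

(** Otherwise [q] could be deleted, with [s] standing in for it. *)
Lemma safe_minimal (q s : state A) : safe_eq q s -> q = s.
Proof.
move=> qs; apply/eqP/negPn/negP => neq_qs; case: A_min => AL A_le.
pose K := [set~ q].
have K_rep (p : state A) : exists2 k : state A, k \in K & safe_eq k p.
  have [->|neq_pq] := eqVneq p q; last by exists p; rewrite ?inE.
  by exists s; [rewrite !inE eq_sym | exact: safe_eq_sym].
have [| |C /A_le le_AC Ck] := @restriction_GFG_tNCW A L K A_det AL.
- by move=> p; have [k kK [_ le_pk]] := K_rep p; exists k.
- by move=> k a _ _; exact: K_rep.
by move: le_AC; rewrite Ck /K cardsC1; case: #|_| (fintype0 q) => // n _; rewrite ltnn.
Qed.

(** Otherwise the safe component of [q] could be deleted: the state reached from [q] by a safe word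
    [u] lies below the one reached from [s] by [u], which normality keeps outside that component. *)
Lemma safe_centralized (A_norm : normal A) (q s : state A) :
  safe_le q s -> connect (@safe_step _ A) q s.
Proof.
move=> le_qs; apply/negPn/negP => not_qs; case: A_min => AL A_le.
pose K := [set p | ~~ connect (@safe_step _ A) q p].
have [| |C /A_le le_AC Ck] := @restriction_GFG_tNCW A L K A_det AL.
- move=> p; case: (boolP (p \in K)) => [pK|]; first by exists p.
  rewrite inE negbK => /(connect_safe_word A_det)[u su <-].
  exists (foldl (@succ A) s u); last exact: safe_le_foldl.
  rewrite inE; apply: contra not_qs => /connect_trans; apply; apply: A_norm.
  by apply/connect_safe_word => //; exists u => //; case: le_qs => _; apply.
- move=> k a; rewrite inE => kK sa; exists (succ k a) => //.
  rewrite inE; apply: contra kK => /connect_trans; apply; apply: A_norm.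
  by apply/connect_safe_word => //; exists [:: a]; rewrite //= sa.
move: le_AC; rewrite Ck leqNgt => /negP; apply.
rewrite -cardsT; apply: proper_card; rewrite properT.
by apply/negP => /eqP/setP/(_ q); rewrite !inE connect0.
Qed.

End Minimal.

(** * Pumping safe cycles to compare two automata *)

Section Pumping.
Variables (A B : tNCW Sigma) (A_det : deterministic A) (A_norm : normal A).
Variable q : state A.

Section Word.
Variable g : state B -> seq Sigma.
Hypothesis gP : forall s, equiv q s ->
  [/\ safe_word q (g s), foldl (@succ A) q (g s) = q & ~~ safe_word s (g s)].

(* The word [g s1 ++ g s2 ++ ...], where [s_i] is the state of [B] reached when
   the i-th block starts, is generated letter by letter: a configuration is the
   current state of [B] with the unread part of the current block. *)
Definition pending (x : state B * seq Sigma) : seq Sigma :=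
  if x.2 is [::] then g x.1 else x.2.

Variable a0 : Sigma.

Definition pump_step (x : state B * seq Sigma) : state B * seq Sigma :=
  (succ x.1 (head a0 (pending x)), behead (pending x)).

Variable s0 : state B.
Hypothesis equiv_s0 : equiv q s0.

Let conf i := iter i pump_step (s0, [::]).
Let w i := head a0 (pending (conf i)).

Lemma conf_run i : (conf i).1 = det_run s0 w i.
Proof. by elim: i => //= i <-. Qed.

(** Each block is a safe cycle at [q], so the unread part of a block leads safely back to [q]. *)
Lemma conf_invariant i :
  [/\ equiv (det_run q w i) (conf i).1, safe_word (det_run q w i) (conf i).2,
      foldl (@succ A) (det_run q w i) (conf i).2 = q
    & safe (det_run q w i) (w i)].
Proof.
pose P (p : state A) (x : state B * seq Sigma) :=
  [/\ equiv p x.1, safe_word p x.2 & foldl (@succ A) p x.2 = q].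
have stepP p x : P p x -> safe p (head a0 (pending x)) /\
    P (succ p (head a0 (pending x))) (pump_step x).
  case: x => s [|a v]; rewrite /P /pump_step /pending /=; last first.
    by move=> [E /andP[-> sv] Ev]; split=> //; split=> //; exact: equiv_succ.
  move=> [E _ Ep]; subst p; have [] := gP E.
  case: (g s) => [|a v] //= /andP[-> sv] Ev _.
  by split=> //; split=> //; exact: equiv_succ.
have Pi j : P (det_run q w j) (conf j).
  elim: j => [|j /stepP[_]]; first by [].
  by rewrite /conf iterS.
by have [? ? ?] := Pi i; have [? _] := stepP _ _ (Pi i).
Qed.

Lemma conf_unsafe v i : pending (conf i) = v -> ~~ safe_word (conf i).1 v ->
  exists2 j, i <= j & ~~ safe (conf j).1 (w j).
Proof.
elim: v i => //= a v IHv i Ev.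
case: (boolP (safe (conf i).1 a)) => [sa /=|sa _]; last first.
  by exists i; rewrite // /w Ev.
have E1 : (conf i.+1).1 = succ (conf i).1 a by rewrite /conf iterS /= -/(conf i) Ev.
have E2 : (conf i.+1).2 = v by rewrite /conf iterS /= -/(conf i) Ev.
rewrite -E1 => sv.
have [|j lt_ij Hj] := IHv i.+1 _ sv; last by exists j => //; exact: ltnW.
(* With [v] empty, [pending] would open a new block; but the empty word is safe, against [sv]. *)
by rewrite /pending E2; case: v sv {IHv Ev E2}.
Qed.

Lemma conf_boundary v i : (conf i).2 = v ->
  exists2 j, i <= j & (conf j).2 = [::].
Proof.
elim: v i => [|a v IHv] i Ev; first by exists i.
have [|j lt_ij Hj] := IHv i.+1; last by exists j => //; exact: ltnW.
by rewrite /conf iterS /= -/(conf i) /pending Ev.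
Qed.

(** The word [w] is read safely from [q], hence accepted from [s0]; yet blocks start arbitrarily
    late, and each is unsafe from the state of [B] where it starts. *)
Lemma pump_contradiction : False.
Proof.
have [n Hn] : det_lang s0 w.
  by apply/equiv_s0; exists 0 => i _; case: (conf_invariant i).
have [j le_nj Ej] := conf_boundary (erefl (conf n).2).
have [E _ Eq _] := conf_invariant j.
rewrite Ej /= in Eq; rewrite Eq in E; have [_ _ Hg] := gP E.
have [|m le_jm] := @conf_unsafe (g (conf j).1) j _ Hg.
  by rewrite /pending Ej.
by rewrite conf_run Hn // (leq_trans le_nj).
Qed.

End Word.

Lemma exists_safe_le (s0 : state B) : equiv q s0 ->
  exists s : state B, safe_le q s.
Proof.
move=> E0; apply: boolp.contrapT => no_le.
have /boolp.choice[g gP] (s : state B) : exists v, equiv q s ->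
    [/\ safe_word q v, foldl (@succ A) q v = q & ~~ safe_word s v].
  case: (boolp.pselect (equiv q s)) => [E|]; last by exists [::].
  have [u su nu] : exists2 u, safe_word q u & ~~ safe_word s u.
    apply: boolp.contrapT => H; apply: no_le; exists s; split=> // u su.
    by apply/negPn/negP => nu; apply: H; exists u.
  (* Normality closes [u] into a safe cycle at [q]. *)
  have /A_norm/(connect_safe_word A_det)[v sv Ev] :
      connect (@safe_step _ A) q (foldl (@succ A) q u).
    by apply/connect_safe_word => //; exists u.
  exists (u ++ v) => _; rewrite !safe_word_cat foldl_cat su sv Ev.
  by split=> //; rewrite (negPf nu).
(* The block [g s0] is unsafe from [s0], hence nonempty; its first letter serves as the default for
   [head]. *)
have [_ _] := gP _ E0; case Eg : (g s0) => [|a v] // _.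
exact: (pump_contradiction gP a E0).
Qed.

End Pumping.

(** * Matching the states of the two automata *)

Lemma exists_equiv L A B (q : state A) :
  deterministic A -> deterministic B -> recognizes A L -> recognizes B L ->
  all_reachable A -> exists s : state B, equiv q s.
Proof.
move=> A_det B_det AL BL /(_ q)/(connect_step_word A_det)[u <-].
exists (foldl (@succ B) (init B) u); apply: equiv_foldl => w.
by rewrite -!language_det // AL BL.
Qed.

Lemma exists_safe_eq L A B (q : state A) :
  deterministic A -> deterministic B -> GFG_minimal L A -> recognizes B L ->
  all_reachable A -> normal A -> all_reachable B -> normal B ->
  exists s : state B, safe_eq q s.
Proof.
move=> A_det B_det A_min BL A_reach A_norm B_reach B_norm.
have [AL _] := A_min.
have [p le_qp p_max] := safe_le_maximal q.
have [s0 E0] := exists_equiv p A_det B_det AL BL A_reach.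
have [s le_ps] := exists_safe_le A_det A_norm E0.
have [p0 E1] := exists_equiv s B_det A_det BL AL B_reach.
have [p' le_sp'] := exists_safe_le B_det B_norm E1.
(* From [p <= s <= p'], maximality of [p] gives [p' <= p], so [s <= p]. *)
have ps : safe_eq p s.
  split=> //; apply: (safe_le_trans le_sp'); apply: p_max.
  exact: safe_le_trans le_ps le_sp'.
(* Some safe word [u] leads from [p] back to [q]; reading it from [s] yields the partner of [q]. *)
have /A_norm/(connect_safe_word A_det)[u su <-] :=
  safe_centralized A_det A_min A_norm le_qp.
by exists (foldl (@succ B) s u); exact: safe_eq_foldl.
Qed.

(** A GFG-tNCW smaller than [A] would put the least size of a GFG-tNCW for [L] below that of a
    tDCW. *)
Lemma not_helpful_GFG_minimal L A :
  ~ GFG_helpful L -> minimal_tDCW_for L A -> GFG_minimal L A.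
Proof.
move=> not_helpful [[_ AL] A_min]; split=> // C CL; rewrite leqNgt.
apply/negP => lt_CA; apply: not_helpful.
pose P n := boolp.asbool (exists2 D, GFG_tNCW_for L D & #|state D| = n).
have exP : exists n, P n by exists #|state C|; apply/boolp.asboolP; exists C.
have n_min D : GFG_tNCW_for L D -> ex_minn exP <= #|state D|.
  move=> DL; case: ex_minnP => n _; apply.
  by apply/boolp.asboolP; exists D.
exists #|state A|, (ex_minn exP); split=> //.
  by split=> //; case: ex_minnP => n /boolp.asboolP.
exact: leq_ltn_trans (n_min C CL) lt_CA.
Qed.

End Residuals.

Theorem theorem4p18 (Sigma : finType) (L : omega_language Sigma)
    (L_regular : omega_regular L) (L_not_helpful : ~ GFG_helpful L)
    (A B : tNCW Sigma)
    (A_nice : nice A) (A_minimal : minimal_tDCW_for L A)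
    (B_nice : nice B) (B_minimal : minimal_tDCW_for L B) :
  safe_isomorphic A B.
Proof.
have A_min := not_helpful_GFG_minimal L_not_helpful A_minimal.
have B_min := not_helpful_GFG_minimal L_not_helpful B_minimal.
have [[A_det AL] _] := A_minimal; have [[B_det BL] _] := B_minimal.
have [_ [A_reach _ A_norm _ _]] := A_nice.
have [_ [B_reach _ B_norm _ _]] := B_nice.
have /boolp.choice[kappa kappaP] (q : state A) : exists s : state B, safe_eq q s.
  by apply: (@exists_safe_eq _ L).
have /boolp.choice[lambda lambdaP] (s : state B) : exists q : state A, safe_eq s q.
  by apply: (@exists_safe_eq _ L).
have kappaK : cancel kappa lambda.
  move=> q; apply/esym/(safe_minimal A_det A_min).
  exact: safe_eq_trans (kappaP q) (lambdaP _).
exists kappa.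
  exists lambda => // s; apply/esym/(safe_minimal B_det B_min).
  exact: safe_eq_trans (lambdaP s) (kappaP _).
move=> q q' a; rewrite !safe_deltaE // (safe_eq_safe a (kappaP q)).
case: (boolP (safe (kappa q) a)) => //= sa.
(* Both states are [safe_eq] to [succ q a], so minimality of [B] makes them equal. *)
suff <- : kappa (succ q a) = succ (kappa q) a by rewrite (inj_eq (can_inj kappaK)).
apply: (safe_minimal B_det B_min).
apply: safe_eq_trans (safe_eq_sym (kappaP _)) _.
have := safe_eq_foldl (u := [:: a]) (kappaP q).
by rewrite /= (safe_eq_safe a (kappaP q)) sa; apply.
Qed.
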